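(* There exists a computationally efficient algorithm which, given an explicit product distribution $Q$ over $\{0,1\}^n$ (via its mean vector), a parameter $\epsilon>0$, and sample access to an unknown product distribution $P$ over $\{0,1\}^n$, takes $O(\sqrt n/\epsilon^2)$ samples from $P$ and distinguishes with probability at least $2/3$ between the cases $P=Q$ and $\|P-Q\|_1>\epsilon$.
   Context: A product distribution over $\{0,1\}^n$ is one with independent coordinates; it is determined by its mean vector $q$ with $q_i=\Pr[X_i=1]$. $\|P-Q\|_1=\sum_{x}|P(x)-Q(x)|$. ''Distinguishes'' means: outputs accept with probability at least $2/3$ if $P=Q$, and reject with probability at least $2/3$ if $\|P-Q\|_1>\epsilon$ (arbitrary output otherwise). *)

(* Defs.v *)
From HB Require Import structures.
From mathcomp Require Import all_boot all_order all_algebra.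
From mathcomp Require Import reals.

Set Implicit Arguments.
Unset Strict Implicit.
Unset Printing Implicit Defensive.

Import Order.TTheory GRing.Theory Num.Theory.
Local Open Scope ring_scope.

Definition cube (n : nat) := {ffun 'I_n -> bool}.

Section Distributions.
Context {R : realType} {n : nat}.
Implicit Types P Q : {ffun cube n -> R}.

Definition is_distr P : Prop :=
  (forall x, 0 <= P x) /\ \sum_(x : cube n) P x = 1.

Definition coord_pr P (i : 'I_n) (b : bool) : R :=
  \sum_(x : cube n | x i == b) P x.

Definition is_product_distr P : Prop :=
  is_distr P /\ forall x : cube n, P x = \prod_(i < n) coord_pr P i (x i).

Definition mean_vector P : {ffun 'I_n -> R} := [ffun i => coord_pr P i true].

Definition l1_dist P Q : R := \sum_(x : cube n) `|P x - Q x|.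

End Distributions.

(* Algorithms are programs for a real RAM (unit-cost exact arithmetic and      *)
(* comparisons on reals, no rounding) extended with a sample oracle and fair   *)
(* coin flips. The memory consists of natural-number registers, used for       *)
(* counting and addressing, and of real arrays. The syntax mentions neither n  *)
(* nor R, so one finite program has to serve all inputs. As usual for a real  *)
(* RAM there is no floor or other map from reals to naturals, and natural      *)
(* registers have no multiplication or division.                               *)

Inductive nexp : Type :=
  | NConst of nat
  | NReg of nat
  | NAdd of nexp & nexp
  | NSub of nexp & nexp.

Inductive rexp : Type :=
  | RNat of nexp
  | RCell of nat & nexp
  | RAdd of rexp & rexp
  | RSub of rexp & rexp
  | RMul of rexp & rexp
  | RDiv of rexp & rexp.

Inductive bexp : Type :=
  | BNLt of nexp & nexp
  | BRLt of rexp & rexp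
  | BNot of bexp
  | BAnd of bexp & bexp.

Inductive cmd : Type :=
  | Skip
  | SetN of nat & nexp
  | SetR of nat & nexp & rexp
  | Draw of nat
  | Flip of nat
  | Seq of cmd & cmd
  | If of bexp & cmd & cmd
  | While of bexp & cmd.

Section Semantics.
Context {R : realType}.

Record state : Type := State { nreg : nat -> nat; rarr : nat -> nat -> R }.

Definition set_nreg (s : state) (r v : nat) : state :=
  State (fun r' => if r' == r then v else nreg s r') (rarr s).

Definition set_cell (s : state) (a i : nat) (v : R) : state :=
  State (nreg s)
    (fun a' i' => if (a' == a) && (i' == i) then v else rarr s a' i').

Definition load_sample (n : nat) (s : state) (a : nat) (x : cube n) : state :=
  State (nreg s)
    (fun a' i => if a' == a
                 then if insub i is Some j then (x j : nat)%:R else rarr s a' i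
                 else rarr s a' i).

Fixpoint neval (s : state) (e : nexp) : nat :=
  match e with
  | NConst k => k
  | NReg r => nreg s r
  | NAdd e1 e2 => (neval s e1 + neval s e2)%N
  | NSub e1 e2 => (neval s e1 - neval s e2)%N
  end.

(* Division by zero returns 0. *)
Fixpoint reval (s : state) (e : rexp) : R :=
  match e with
  | RNat e1 => (neval s e1)%:R
  | RCell a e1 => rarr s a (neval s e1)
  | RAdd e1 e2 => reval s e1 + reval s e2
  | RSub e1 e2 => reval s e1 - reval s e2
  | RMul e1 e2 => reval s e1 * reval s e2
  | RDiv e1 e2 => reval s e1 / reval s e2
  end.

Fixpoint beval (s : state) (b : bexp) : bool :=
  match b with
  | BNLt e1 e2 => (neval s e1 < neval s e2)%N
  | BRLt e1 e2 => reval s e1 < reval s e2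
  | BNot b1 => ~~ beval s b1
  | BAnd b1 b2 => beval s b1 && beval s b2
  end.

(* The sequence holds the commands that remain to be executed. *)
Definition config : Type := (seq cmd * state)%type.

Inductive outcome (n : nat) : Type :=
  | Halted of bool
  | Continue of config
  | AskSample of (cube n -> config)
  | AskCoin of (bool -> config).

(* Register 0 holds the answer: the program accepts iff it is nonzero. *)
Definition step (n : nat) (c : config) : outcome n :=
  let: (k, s) := c in
  match k with
  | [::] => Halted n (nreg s 0 != 0%N)
  | Skip :: k' => Continue n (k', s)
  | SetN r e :: k' => Continue n (k', set_nreg s r (neval s e))
  | SetR a e v :: k' => Continue n (k', set_cell s a (neval s e) (reval s v))
  | Draw a :: k' => AskSample (fun x : cube n => (k', load_sample s a x))
  | Flip r :: k' => AskCoin n (fun b => (k', set_nreg s r b))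
  | Seq c1 c2 :: k' => Continue n ([:: c1, c2 & k'], s)
  | If b c1 c2 :: k' => Continue n ((if beval s b then c1 else c2) :: k', s)
  | While b c1 :: k' =>
      Continue n (if beval s b then [:: c1, While b c1 & k'] else k', s)
  end.

(* On every sequence of oracle answers and coin flips, the run from c halts    *)
(* after at most t steps and at most m oracle calls.                           *)
Fixpoint halts_within (n t m : nat) (c : config) : Prop :=
  match step n c, t with
  | Halted _, _ => True
  | _, 0%N => False
  | Continue c', t'.+1 => halts_within n t' m c'
  | AskSample k, t'.+1 =>
      if m is m'.+1 then forall x, halts_within n t' m' (k x) else False
  | AskCoin k, t'.+1 => forall b, halts_within n t' m (k b)
  end.

(* Probability that the run from c halts after at most t steps with answer b,  *)
(* each oracle call returning a fresh independent sample from P.               *)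
Fixpoint answer_pr (n : nat) (P : {ffun cube n -> R}) (b : bool) (t : nat)
    (c : config) : R :=
  match step n c, t with
  | Halted b', _ => (b' == b)%:R
  | _, 0%N => 0
  | Continue c', t'.+1 => answer_pr P b t' c'
  | AskSample k, t'.+1 => \sum_(x : cube n) P x * answer_pr P b t' (k x)
  | AskCoin k, t'.+1 =>
      (answer_pr P b t' (k true) + answer_pr P b t' (k false)) / 2%:R
  end.

(* Input format: n in register 1, q in array 0, eps in cell 0 of array 1;      *)
(* all other memory is zero.                                                   *)
Definition init_state (n : nat) (q : {ffun 'I_n -> R}) (eps : R) : state :=
  State (fun r => if r == 1%N then n else 0%N)
    (fun a i => match a with
                | 0%N => if insub i is Some j then q j else 0
                | 1%N => if i == 0%N then eps else 0
                | _ => 0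
                end).

Definition init_config (prog : cmd) (n : nat) (q : {ffun 'I_n -> R}) (eps : R)
  : config := ([:: prog], init_state q eps).

End Semantics.

(* Main.v *)
Require Import Defs.
From HB Require Import structures.
From mathcomp Require Import all_boot all_order all_algebra.
From mathcomp Require Import reals.
From mathcomp Require Import ring lra zify.

Set Implicit Arguments.
Unset Strict Implicit.
Unset Printing Implicit Defensive.

Import Order.TTheory GRing.Theory Num.Theory.
Local Open Scope ring_scope.

(* Draw two independent batches of [m = O(sqrt n / eps^2)] samples and let
   [A_i], [B_i] be the centred counts of coordinate [i] in the two batches. The
   statistic is [Z = sum_i A_i B_i / v_i] with [v_i = q_i (1 - q_i) + eps^2 / n].
   With [S = sum_i (p_i - q_i)^2 / v_i] its mean is [m^2 S], and because distinct
   coordinates are uncorrelated its variance is an explicit sum over coordinates.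
   The squared l1 distance is at most [4 (1 - BC^2)], where the Bhattacharyya
   coefficient [BC] is a product over coordinates, whence
   [l1^2 <= 16 S + eps^2 / 2]; so [P = Q] gives mean [0] and an [eps]-far [P] gives
   mean at least [m^2 eps^2 / 32], and Chebyshev's inequality separates the two
   cases at the threshold [m^2 eps^2 / 64]. The regularizer [eps^2 / n] in [v_i]
   tames the coordinates with [q_i] near [0] or [1]. *)

(** * Expectation over lists of independent samples *)

Section Expectation.
Context {R : realType} {n : nat}.
Variable P : {ffun cube n -> R}.

(** The average is taken one sample at a time, first sample outermost, to match the recursion of
    [answer_pr]. *)
Fixpoint expect (m : nat) (g : seq (cube n) -> R) : R :=
  if m is m'.+1
  then \sum_(x : cube n) P x * expect m' (fun xs => g (x :: xs))
  else g [::].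

Lemma eq_expect m g h :
  (forall xs, size xs = m -> g xs = h xs) -> expect m g = expect m h.
Proof.
elim: m g h => [|m IH] g h e /=; first exact: e.
by apply: eq_bigr => x _; congr (_ * _); apply: IH => xs sz; apply: e; rewrite /= sz.
Qed.

Lemma expect_cat m1 m2 g :
  expect (m1 + m2) g = expect m1 (fun xs => expect m2 (fun ys => g (xs ++ ys))).
Proof.
elim: m1 g => [|m1 IH] g //=.
by apply: eq_bigr => x _; rewrite IH.
Qed.

Lemma expectD m g h :
  expect m (fun xs => g xs + h xs) = expect m g + expect m h.
Proof.
elim: m g h => [|m IH] g h //=.
by rewrite -big_split; apply: eq_bigr => x _; rewrite IH mulrDr.
Qed.

Lemma expectZ m c g : expect m (fun xs => c * g xs) = c * expect m g.
Proof.
elim: m g => [|m IH] g //=.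
by rewrite mulr_sumr; apply: eq_bigr => x _; rewrite IH mulrCA.
Qed.

Lemma expectZr m c g : expect m (fun xs => g xs * c) = expect m g * c.
Proof. by rewrite mulrC -expectZ; apply: eq_expect => xs _; rewrite mulrC. Qed.

Lemma expect_sum (I : Type) (r : seq I) m (F : I -> seq (cube n) -> R) :
  expect m (fun xs => \sum_(i <- r) F i xs) = \sum_(i <- r) expect m (F i).
Proof.
elim: r => [|i r IH].
  rewrite big_nil (@eq_expect m _ (fun xs => 0 * 0)); first by rewrite expectZ mul0r.
  by move=> xs _; rewrite big_nil mul0r.
rewrite big_cons -IH -expectD.
by apply: eq_expect => xs _; rewrite big_cons.
Qed.

Hypothesis distrP : is_distr P.

Lemma expect_cst m c : expect m (fun _ => c) = c.
Proof.
case: distrP => _ P1.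
by elim: m => [|m IH] //=; under eq_bigr do rewrite IH; rewrite -mulr_suml P1 mul1r.
Qed.

Lemma le_expect m g h :
  (forall xs, size xs = m -> g xs <= h xs) -> expect m g <= expect m h.
Proof.
case: distrP => P0 _.
elim: m g h => [|m IH] g h le_gh /=; first exact: le_gh.
apply: ler_sum => x _; apply: ler_wpM2l => //.
by apply: IH => xs sz; apply: le_gh; rewrite /= sz.
Qed.

End Expectation.

(** * First and second moments of the coordinates of a product law *)

Section ProductMoments.
Context {R : realType} {n : nat}.
Variable P : {ffun cube n -> R}.
Hypothesis prodP : is_product_distr P.

Let p i := coord_pr P i true.

Let distrP : is_distr P. Proof. by case: prodP. Qed.

Lemma coord_pr_false i : coord_pr P i false = 1 - p i.
Proof.
apply/eqP; rewrite eq_sym subr_eq; apply/eqP.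
case: distrP => _ <-; rewrite addrC /p /coord_pr (bigID (fun x : cube n => x i == true)).
by congr (_ + _); apply: eq_bigl => x /=; case: (x i).
Qed.

Lemma coord_pr_ge0 i b : 0 <= coord_pr P i b.
Proof. by apply: sumr_ge0 => x _; case: distrP => ->. Qed.

Lemma mean_in01 i : 0 <= p i <= 1.
Proof.
rewrite coord_pr_ge0 /=.
by have := coord_pr_ge0 i false; rewrite coord_pr_false subr_ge0.
Qed.

(** Independence of the coordinates, as distributivity of the product over the sum. Moments follow
    by taking factors equal to 1 away from the relevant coordinates. *)
Lemma sum_coord_pr (f : 'I_n -> bool -> R) :
  \sum_(x : cube n) P x * \prod_i f i (x i)
  = \prod_i (p i * f i true + (1 - p i) * f i false).
Proof.
transitivity (\sum_(x : cube n) \prod_i (coord_pr P i (x i) * f i (x i))).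
  by apply: eq_bigr => x _; case: prodP => _ ->; rewrite -big_split.
rewrite -(bigA_distr_bigA (fun i b => coord_pr P i b * f i b)).
by apply: eq_bigr => i _; rewrite big_bool coord_pr_false.
Qed.

Lemma coord_mean i (q : R) :
  \sum_(x : cube n) P x * ((x i : nat)%:R - q) = p i - q.
Proof.
pose f k (b : bool) : R := if k == i then (b : nat)%:R - q else 1.
transitivity (\sum_(x : cube n) P x * \prod_k f k (x k)).
  apply: eq_bigr => x _; congr (_ * _).
  rewrite (bigD1 i) //= /f eqxx big1 ?mulr1 // => k /negbTE -> //.
rewrite sum_coord_pr (bigD1 i) //= big1; last first.
  by move=> k /negbTE ki; rewrite /f ki; ring.
by rewrite /f eqxx /=; ring.
Qed.

Lemma coord_covariance i j (qi qj : R) :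
  \sum_(x : cube n) P x * (((x i : nat)%:R - qi) * ((x j : nat)%:R - qj))
  = (p i - qi) * (p j - qj) + (i == j)%:R * (p i * (1 - p i)).
Proof.
(* As a product of two selectors, [f] also covers [i = j], where both act on the same bit and
   produce the variance term. *)
pose f k (b : bool) : R := (if k == i then (b : nat)%:R - qi else 1)
  * (if k == j then (b : nat)%:R - qj else 1).
transitivity (\sum_(x : cube n) P x * \prod_k f k (x k)).
  apply: eq_bigr => x _; congr (_ * _); rewrite /f big_split /=; congr (_ * _).
    by rewrite (bigD1 i) //= eqxx big1 ?mulr1 // => k /negbTE -> //.
  by rewrite (bigD1 j) //= eqxx big1 ?mulr1 // => k /negbTE -> //.
rewrite sum_coord_pr (bigD1 i) //=; rewrite /f; have [<-|neq_ij] := eqVneq i j.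
  rewrite big1 ?mulr1; last by move=> k /negbTE ki; rewrite ki; ring.
  by rewrite eqxx /=; ring.
rewrite (bigD1 j) 1?eq_sym //= big1 ?mulr1; last first.
  by move=> k /andP[/negbTE ki /negbTE kj]; rewrite ki kj; ring.
by rewrite !eqxx (negbTE neq_ij) /=; ring.
Qed.

End ProductMoments.

(** * Mean and variance of the two-batch statistic *)

Section BatchStatistic.
Context {R : realType} {n : nat}.
Variables (P : {ffun cube n -> R}) (q w : 'I_n -> R).
Hypothesis prodP : is_product_distr P.

Let delta i := coord_pr P i true - q i.
Let var i := coord_pr P i true * (1 - coord_pr P i true).

Definition batch_dev (xs : seq (cube n)) (i : 'I_n) : R :=
  \sum_(x <- xs) ((x i : nat)%:R - q i).

Definition two_batch_stat (xs ys : seq (cube n)) : R :=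
  \sum_i w i * (batch_dev xs i * batch_dev ys i).

Let distrP : is_distr P. Proof. by case: prodP. Qed.
Let sumP : \sum_x P x = 1. Proof. by case: distrP. Qed.

Lemma expect_batch_dev m i : expect P m (fun xs => batch_dev xs i) = m%:R * delta i.
Proof.
elim: m => [|m IH] /=; first by rewrite /batch_dev big_nil mul0r.
under eq_bigr => x _.
  rewrite (@eq_expect _ _ _ m _ (fun xs => ((x i : nat)%:R - q i) + batch_dev xs i));
    last by move=> xs _; rewrite /batch_dev big_cons.
  rewrite expectD expect_cst // IH mulrDr.
  over.
by rewrite big_split /= coord_mean // -mulr_suml sumP -natr1 /delta; ring.
Qed.

(** Peeling off one sample, independent of the rest: means accumulate linearly and give [m ^ 2],
    while only the diagonal collects a variance, once per sample. *)
Lemma expect_batch_dev2 m i j :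
  expect P m (fun xs => batch_dev xs i * batch_dev xs j)
  = m%:R ^+ 2 * (delta i * delta j) + (i == j)%:R * (m%:R * var i).
Proof.
elim: m => [|m IH] /=; first by rewrite /batch_dev !big_nil; ring.
under eq_bigr => x _.
  pose y k : R := (x k : nat)%:R - q k.
  rewrite (@eq_expect _ _ _ m _ (fun xs => y i * y j +
      (y i * batch_dev xs j + (batch_dev xs i * y j + batch_dev xs i * batch_dev xs j))));
    last by move=> xs _; rewrite /batch_dev !big_cons /y; ring.
  rewrite !expectD expect_cst // expectZ expectZr IH !expect_batch_dev /y.
  (* Each summand is brought to a constant times [P x] times a coordinate term, so that the sums
     over [x] become moments. *)
  rewrite (mulrDr _ (_ * _)) (mulrDr _ (_ * (m%:R * delta j))) (mulrDr _ (m%:R * _ * _)).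
  rewrite (mulrA (P x) _ (m%:R * _)) (mulrCA (P x) (m%:R * _)).
  over.
rewrite !big_split /= coord_covariance // -mulr_suml -mulr_sumr -mulr_suml.
by rewrite !coord_mean // sumP -natr1 /delta /var; ring.
Qed.

(* The two batches are independent, so [E Z^2] needs only the covariances of
   one batch: [E Z^2 = sum_(i,j) w_i w_j (E A_i A_j)^2]. *)
Lemma two_batch_variance m (mu := m%:R ^+ 2 * \sum_i w i * delta i ^+ 2) :
  expect P m (fun xs => expect P m (fun ys => (two_batch_stat xs ys - mu) ^+ 2))
  = \sum_i w i ^+ 2 * (2%:R * m%:R ^+ 3 * delta i ^+ 2 * var i
                       + m%:R ^+ 2 * var i ^+ 2).
Proof.
have EZ : expect P m (fun xs => expect P m (two_batch_stat xs)) = mu.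
  rewrite (@eq_expect _ _ _ m _
      (fun xs => \sum_i (w i * batch_dev xs i) * (m%:R * delta i))); last first.
    move=> xs _; rewrite expect_sum; apply: eq_bigr => i _.
    by rewrite expectZ expectZ expect_batch_dev mulrA.
  rewrite expect_sum /mu mulr_sumr; apply: eq_bigr => i _.
  by rewrite expectZr expectZ expect_batch_dev; ring.
have EZ2 : expect P m (fun xs => expect P m (fun ys => two_batch_stat xs ys ^+ 2))
  = \sum_i \sum_j w i * w j *
      (m%:R ^+ 2 * (delta i * delta j) + (i == j)%:R * (m%:R * var i)) ^+ 2.
  rewrite (@eq_expect _ _ _ m _ (fun xs => \sum_i \sum_j
      (w i * w j * (m%:R ^+ 2 * (delta i * delta j) + (i == j)%:R * (m%:R * var i)))
      * (batch_dev xs i * batch_dev xs j))); last first.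
    move=> xs _.
    rewrite (@eq_expect _ _ _ m _ (fun ys => \sum_i \sum_j
        (w i * w j * (batch_dev xs i * batch_dev xs j))
        * (batch_dev ys i * batch_dev ys j))); last first.
      move=> ys _; rewrite expr2 /two_batch_stat mulr_suml.
      apply: eq_bigr => i _; rewrite mulr_sumr; apply: eq_bigr => j _; ring.
    rewrite expect_sum; apply: eq_bigr => i _.
    rewrite expect_sum; apply: eq_bigr => j _.
    by rewrite expectZ expect_batch_dev2; ring.
  rewrite expect_sum; apply: eq_bigr => i _.
  rewrite expect_sum; apply: eq_bigr => j _.
  by rewrite expectZ expect_batch_dev2; ring.
rewrite (@eq_expect _ _ _ m _ (fun xs =>
    expect P m (fun ys => two_batch_stat xs ys ^+ 2)
    + ((- (2%:R * mu)) * expect P m (two_batch_stat xs) + mu ^+ 2))); last first.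
  move=> xs _; rewrite -expectZ -(@expect_cst _ _ P distrP m (mu ^+ 2)) -!expectD.
  by apply: eq_expect => ys _; ring.
rewrite !expectD expectZ expect_cst // EZ EZ2.
pose S := \sum_j w j * delta j ^+ 2.
(* Off the diagonal only products of means remain; extended to all [j] they sum to [mu ^+ 2] over
   all rows. The diagonal excess is the cross term and the squared variance term. *)
have row i : \sum_j w i * w j *
      (m%:R ^+ 2 * (delta i * delta j) + (i == j)%:R * (m%:R * var i)) ^+ 2
  = m%:R ^+ 4 * S * (w i * delta i ^+ 2) +
    w i ^+ 2 * (2%:R * m%:R ^+ 3 * delta i ^+ 2 * var i + m%:R ^+ 2 * var i ^+ 2).
  rewrite /S [in RHS](bigD1 i) //= (bigD1 i) //= eqxx /=.
  rewrite (eq_bigr (fun j => m%:R ^+ 4 * (w i * delta i ^+ 2) * (w j * delta j ^+ 2)));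
    last by move=> j /negbTE ji; rewrite eq_sym ji /=; ring.
  by rewrite -mulr_sumr /=; move: (delta i) (var i) (\sum_(j < n | _) _) => a b c; ring.
under eq_bigr do rewrite row.
by rewrite big_split /= -mulr_sumr -/S /mu -/S; move: (\sum_i _) (S) => a b; ring.
Qed.

End BatchStatistic.

(** * The l1 distance, Hellinger affinity and the chi-square sum *)

(** Lagrange's identity: twice the gap is a double sum of squares. *)
Lemma sum_Cauchy_Schwarz (R : realDomainType) (I : finType) (f g : I -> R) :
  (\sum_x f x * g x) ^+ 2 <= (\sum_x f x ^+ 2) * (\sum_x g x ^+ 2).
Proof.
have : 0 <= \sum_x \sum_y (f x * g y - f y * g x) ^+ 2.
  by apply: sumr_ge0 => x _; apply: sumr_ge0 => y _; apply: sqr_ge0.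
rewrite (_ : \sum_x _ = 2%:R * ((\sum_x f x ^+ 2) * (\sum_x g x ^+ 2)
  - (\sum_x f x * g x) ^+ 2)); first by rewrite pmulr_rge0 ?subr_ge0 ?ltr0n.
set F := \sum_x f x ^+ 2; set G := \sum_x g x ^+ 2; set H := \sum_x f x * g x.
transitivity (\sum_x (f x ^+ 2 * G + g x ^+ 2 * F - 2%:R * (f x * g x) * H)).
  apply: eq_bigr => x _.
  rewrite /F /G /H !mulr_sumr -big_split -sumrB /=.
  by apply: eq_bigr => y _; ring.
by rewrite sumrB big_split /= -!mulr_suml -mulr_sumr -/F -/G -/H; ring.
Qed.

(** Induction by [1 - c p = (1 - c) + c (1 - p)]; the bounds on the partial product are carried
    along because the inductive step uses them. *)
Lemma one_sub_prod_le (R : realDomainType) (I : Type) (r : seq I) (c : I -> R) :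
  (forall i, 0 <= c i <= 1) ->
  1 - \prod_(i <- r) c i <= \sum_(i <- r) (1 - c i).
Proof.
move=> c01.
suff [_ []] : 0 <= \prod_(i <- r) c i /\ \prod_(i <- r) c i <= 1 /\
  1 - \prod_(i <- r) c i <= \sum_(i <- r) (1 - c i) by [].
elim: r => [|i r [p0 [p1 IH]]]; first by rewrite !big_nil subrr ler01 lexx.
rewrite !big_cons; have /andP[c0 c1] := c01 i; split; [|split]; nra.
Qed.

(* [e] is [1 - BC^2] for two Bernoulli laws, [BC] their Bhattacharyya coefficient. *)
Lemma bernoulli_hellinger_le (R : realFieldType) (p q tau sp sq tp tq : R)
    (e := 1 - (sp * sq + tp * tq) ^+ 2) :
  0 <= p <= 1 -> 0 <= q <= 1 -> 0 < tau ->
  [/\ 0 <= sp, 0 <= sq, 0 <= tp & 0 <= tq] ->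
  [/\ sp ^+ 2 = p, sq ^+ 2 = q, tp ^+ 2 = 1 - p & tq ^+ 2 = 1 - q] ->
  0 <= e /\ e <= 4%:R * ((p - q) ^+ 2 / (q * (1 - q) + tau)) + tau / 8%:R.
Proof.
move=> /andP[p0 p1] /andP[q0 q1] tau0 [sp0 sq0 tp0 tq0] [spE sqE tpE tqE].
(* Since [sp^2 + tp^2 = sq^2 + tq^2 = 1], Lagrange's identity gives [e = (al - be)^2], and
   [(al - be)(al + be) = p - q]. *)
pose al := sp * tq; pose be := sq * tp.
have eE : e = (al - be) ^+ 2.
  rewrite /e sqrrD !exprMn spE sqE tpE tqE sqrrB !exprMn spE sqE tpE tqE.
  by rewrite /al /be; ring.
have al0 : 0 <= al by apply: mulr_ge0.
have be0 : 0 <= be by apply: mulr_ge0.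
have al2 : al ^+ 2 = p * (1 - q) by rewrite exprMn spE tqE.
have be2 : be ^+ 2 = q * (1 - p) by rewrite exprMn sqE tpE.
have dE : e * (al + be) ^+ 2 = (p - q) ^+ 2.
  rewrite eE -exprMn (_ : (al - be) * (al + be) = al ^+ 2 - be ^+ 2); last by ring.
  by rewrite al2 be2; ring.
have e0 : 0 <= e by rewrite eE sqr_ge0.
have hle : p * (1 - q) + q * (1 - p) <= (al + be) ^+ 2.
  by rewrite sqrrD al2 be2; have := mulr_ge0 al0 be0; lra.
have ele : e <= (al + be) ^+ 2 by rewrite eE; have := mulr_ge0 al0 be0; lra.
have e2 : e ^+ 2 <= (p - q) ^+ 2 by rewrite -dE expr2 ler_wpM2l.
have qq0 : 0 <= q * (1 - q) by apply: mulr_ge0 => //; lra.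
(* For [p <= 1/2] the term [q (1 - p)] is at least [q / 2]; otherwise [p (1 - q)] is at least
   [(1 - q) / 2]. *)
have hq : q * (1 - q) <= 2%:R * (p * (1 - q) + q * (1 - p)).
  by case: (lerP p (1 / 2%:R)) => hp; nra.
have eh : e * (p * (1 - q) + q * (1 - p)) <= (p - q) ^+ 2.
  by rewrite -dE ler_wpM2l.
split => //; clear -e0 tau0 qq0 hq eh e2.
set v := q * (1 - q) + tau; have v0 : 0 < v by rewrite /v; lra.
suff : e * v <= 4%:R * (p - q) ^+ 2 + v * tau / 8%:R.
  rewrite -ler_pdivlMr // => /le_trans; apply; rewrite le_eqVlt; apply/orP; left.
  by apply/eqP; field; rewrite gt_eqF.
(* If [tau <= q (1 - q)], then [v] is at most four times the sum in [eh]. Otherwise [v <= 2 tau],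
   and AM-GM gives [e v <= 4 e^2 + v^2 / 16], where [e^2 <= (p - q)^2]. *)
case: (lerP tau (q * (1 - q))) => h.
  have : v <= 4%:R * (p * (1 - q) + q * (1 - p)) by rewrite /v; lra.
  move=> /(ler_wpM2l e0); have := mulr_ge0 (ltW v0) (ltW tau0); lra.
have vt : v <= 2%:R * tau by rewrite /v; lra.
have := sqr_ge0 (2%:R * e - v / 4%:R).
have := ler_wpM2l (ltW v0) vt; lra.
Qed.

Section Hellinger.
Context {R : realType} {n : nat}.
Variables P Q : {ffun cube n -> R}.
Hypotheses (prodP : is_product_distr P) (prodQ : is_product_distr Q).

Let p i := coord_pr P i true.
Let q i := coord_pr Q i true.

(** Cauchy-Schwarz on [P - Q = (rP - rQ)(rP + rQ)], with [rP], [rQ] the square roots of the laws,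
    gives [l1^2 <= (2 - 2B)(2 + 2B)]. The affinity [B] factors over coordinates, so [1 - B^2] is at
    most the sum of the Bernoulli terms; the factor 4 turns their [4] and [tau / 8] into [16] and
    [tau / 2]. *)
Lemma l1_dist_sqr_le tau : 0 < tau ->
  l1_dist P Q ^+ 2 <=
    16%:R * (\sum_i (p i - q i) ^+ 2 / (q i * (1 - q i) + tau)) + n%:R * tau / 2%:R.
Proof.
move=> tau0.
pose r (S : {ffun cube n -> R}) (x : cube n) := \prod_i Num.sqrt (coord_pr S i (x i)).
have rE S : is_product_distr S -> forall x, S x = r S x ^+ 2.
  move=> pS x; case: (pS) => _ ->; rewrite -prodrXl; apply: eq_bigr => i _.
  by rewrite sqr_sqrtr // coord_pr_ge0.
have r0 S x : 0 <= r S x by apply: prodr_ge0 => i _; apply: sqrtr_ge0.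
have sum1 S : is_product_distr S -> \sum_x r S x ^+ 2 = 1.
  by move=> pS; case: (pS) => -[_ <-] _; apply: eq_bigr => x _; rewrite rE.
pose B := \sum_x r P x * r Q x.
pose c i := (Num.sqrt (p i) * Num.sqrt (q i)
             + Num.sqrt (1 - p i) * Num.sqrt (1 - q i)) ^+ 2.
have BE : B ^+ 2 = \prod_i c i.
  rewrite prodrXl; congr (_ ^+ 2); rewrite /B.
  transitivity (\sum_(x : cube n)
    \prod_i (Num.sqrt (coord_pr P i (x i)) * Num.sqrt (coord_pr Q i (x i)))).
    by apply: eq_bigr => x _; rewrite -big_split.
  rewrite -(bigA_distr_bigA
    (fun i b => Num.sqrt (coord_pr P i b) * Num.sqrt (coord_pr Q i b))).
  by apply: eq_bigr => i _; rewrite big_bool !coord_pr_false.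
have le4 : l1_dist P Q ^+ 2 <= 4%:R * (1 - B ^+ 2).
  have -> : l1_dist P Q = \sum_x `|r P x - r Q x| * (r P x + r Q x).
    apply: eq_bigr => x _; rewrite (rE P) // (rE Q) // subr_sqr normrM.
    by congr (_ * _); rewrite ger0_norm // addr_ge0.
  apply: le_trans (sum_Cauchy_Schwarz _ _) _.
  have -> : \sum_x `|r P x - r Q x| ^+ 2 = 2%:R - 2%:R * B.
    transitivity (\sum_x (r P x ^+ 2 + r Q x ^+ 2 - 2%:R * (r P x * r Q x))).
      by apply: eq_bigr => x _; rewrite real_normK ?num_real //; ring.
    by rewrite sumrB big_split /= -mulr_sumr !sum1.
  have -> : \sum_x (r P x + r Q x) ^+ 2 = 2%:R + 2%:R * B.
    transitivity (\sum_x (r P x ^+ 2 + r Q x ^+ 2 + 2%:R * (r P x * r Q x))).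
      by apply: eq_bigr => x _; ring.
    by rewrite !big_split /= -mulr_sumr !sum1.
  by lra.
have bern i : 0 <= 1 - c i /\
    1 - c i <= 4%:R * ((p i - q i) ^+ 2 / (q i * (1 - q i) + tau)) + tau / 8%:R.
  have /andP[p0 p1] := mean_in01 prodP i; have /andP[q0 q1] := mean_in01 prodQ i.
  apply: bernoulli_hellinger_le; rewrite ?p0 ?q0 //.
    by split; apply: sqrtr_ge0.
  by split; rewrite sqr_sqrtr // subr_ge0.
have Ble : 1 - B ^+ 2 <= \sum_i (1 - c i).
  rewrite BE; apply: one_sub_prod_le => i; rewrite sqr_ge0 /=.
  by have [] := bern i; rewrite subr_ge0.
have /(le_trans Ble) : \sum_i (1 - c i) <= \sum_i (4%:R * ((p i - q i) ^+ 2 / (q i * (1 - q i) + tau))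
    + tau / 8%:R) by apply: ler_sum => i _; case: (bern i).
rewrite big_split /= -mulr_sumr sumr_const card_ord -[_ *+ n]mulr_natl.
set S := \sum_i _ / _; lra.
Qed.

End Hellinger.

(* The variance terms of the two-batch statistic, with [s = delta^2 / v]; the
   coefficients come from AM-GM: [2 m^3 s (|delta|/v) <= m^4 s^2 / 50 + 50 m^2 delta^2/v^2]. *)
Lemma coord_variance_le (R : realFieldType) (p q tau m : R)
    (v := q * (1 - q) + tau) (s := (p - q) ^+ 2 / v) :
  0 <= p <= 1 -> 0 <= q <= 1 -> 0 < tau -> 0 <= m ->
  v^-1 ^+ 2 * (2%:R * m ^+ 3 * (p - q) ^+ 2 * (p * (1 - p))
               + m ^+ 2 * (p * (1 - p)) ^+ 2)
  <= 2%:R * m ^+ 3 * s + m ^+ 4 * s ^+ 2 / 50%:R + 52%:R * m ^+ 2 * (s / tau)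
     + 2%:R * m ^+ 2.
Proof.
move=> /andP[p0 p1] /andP[q0 q1] tau0 m0.
have qq0 : 0 <= q * (1 - q) by apply: mulr_ge0 => //; lra.
have v0 : 0 < v by rewrite /v; lra.
have pp0 : 0 <= p * (1 - p) by apply: mulr_ge0 => //; lra.
pose g := `|p - q| / v; pose rho := p * (1 - p) / v.
have rho0 : 0 <= rho by rewrite divr_ge0 // ltW.
have g0 : 0 <= g by rewrite divr_ge0 // ltW.
have s0 : 0 <= s by rewrite divr_ge0 ?sqr_ge0 // ltW.
(* [p (1 - p) - q (1 - q) = (p - q)(1 - p - q)], and the last factor is at most 1 in absolute
   value. *)
have rho_le : rho <= 1 + g.
  rewrite /rho ler_pdivrMr // mulrDl mul1r divfK ?gt_eqF // /v.
  have h1 : p - q <= `|p - q| by apply: ler_norm.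
  have h2 : - (p - q) <= `|p - q| by rewrite -normrN ler_norm.
  nra.
have g2 : g ^+ 2 <= s / tau.
  rewrite /g expr_div_n real_normK ?num_real // /s expr2 invfM mulrA.
  rewrite ler_wpM2l // lef_pV2 ?posrE // /v; lra.
have -> : v^-1 ^+ 2 * (2%:R * m ^+ 3 * (p - q) ^+ 2 * (p * (1 - p))
               + m ^+ 2 * (p * (1 - p)) ^+ 2)
  = 2%:R * m ^+ 3 * s * rho + m ^+ 2 * rho ^+ 2.
  by rewrite /s /rho; field; rewrite gt_eqF.
have h1 : 2%:R * m ^+ 3 * s * rho <= 2%:R * m ^+ 3 * s * (1 + g).
  by rewrite ler_wpM2l // mulr_ge0 // mulr_ge0 // exprn_ge0.
(* This adds 2 to the AM-GM coefficient 50, whence 52. *)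
have h2 : rho ^+ 2 <= 2%:R + 2%:R * g ^+ 2.
  have : rho ^+ 2 <= (1 + g) ^+ 2 by rewrite lerXn2r ?nnegrE // addr_ge0.
  by have := sqr_ge0 (1 - g); lra.
have {}h2 := ler_wpM2l (sqr_ge0 m) h2.
have {}g2 := ler_wpM2l (sqr_ge0 m) g2.
have := sqr_ge0 (m ^+ 2 * s - 50%:R * (m * g)).
move: (s / tau) h1 h2 g2 => st.
rewrite (_ : (m ^+ 2 * s - 50%:R * (m * g)) ^+ 2 =
  m ^+ 4 * s ^+ 2 - 100%:R * (m ^+ 3 * s * g) + 2500%:R * (m ^+ 2 * g ^+ 2)); last by ring.
rewrite (_ : 2%:R * m ^+ 3 * s * (1 + g) = 2%:R * (m ^+ 3 * s) + 2%:R * (m ^+ 3 * s * g));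
  last by ring.
rewrite (_ : m ^+ 2 * (2%:R + 2%:R * g ^+ 2) = 2%:R * m ^+ 2 + 2%:R * (m ^+ 2 * g ^+ 2));
  last by ring.
lra.
Qed.

Lemma sum_sqr_le (R : realDomainType) (I : finType) (s : I -> R) :
  (forall i, 0 <= s i) -> \sum_i s i ^+ 2 <= (\sum_i s i) ^+ 2.
Proof.
move=> s0; rewrite [leRHS]expr2 mulr_suml; apply: ler_sum => i _.
rewrite expr2 ler_wpM2l // (bigD1 i) //= lerDl.
by apply: sumr_ge0.
Qed.

(** * Variance against squared deviation, in the null and in the far case *)

Section Separation.
Context {R : realType} {n : nat}.
Variables P Q : {ffun cube n -> R}.
Hypotheses (prodP : is_product_distr P) (prodQ : is_product_distr Q).
Variables (m : nat) (eps : R).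
Hypotheses (n_gt0 : (0 < n)%N) (eps0 : 0 < eps).
Hypothesis large_m : 3600%:R ^+ 2 * n%:R <= m%:R ^+ 2 * eps ^+ 4.

Let p i := coord_pr P i true.
Let q i := coord_pr Q i true.
Let tau := eps ^+ 2 / n%:R.
Let v i := q i * (1 - q i) + tau.
Let S := \sum_i (p i - q i) ^+ 2 / v i.
Let V := \sum_i (v i)^-1 ^+ 2 * (2%:R * m%:R ^+ 3 * (p i - q i) ^+ 2 * (p i * (1 - p i))
                          + m%:R ^+ 2 * (p i * (1 - p i)) ^+ 2).

Let n1 : 1 <= n%:R :> R. Proof. by rewrite ler1n. Qed.
Let tau0 : 0 < tau. Proof. by rewrite divr_gt0 ?exprn_gt0 // ltr0n. Qed.
Let v0 i : 0 < v i.
Proof.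
have /andP[q0 q1] := mean_in01 prodQ i.
by rewrite ltr_wpDl // mulr_ge0 // subr_ge0.
Qed.

(** Every coordinate contributes at most [m^2], because [q (1 - q) <= v]. What remains is
    [3 * 64^2 <= 3600^2]. *)
Lemma null_variance_le : P = Q -> 3%:R * V <= (m%:R ^+ 2 * eps ^+ 2 / 64%:R) ^+ 2.
Proof.
move=> PQ.
have Vle : V <= m%:R ^+ 2 * n%:R.
  apply: (@le_trans _ _ (\sum_(i < n) m%:R ^+ 2)); last first.
    by rewrite sumr_const card_ord -[X in X <= _]mulr_natr.
  apply: ler_sum => i _; have /andP[q0 q1] := mean_in01 prodQ i.
  have qq0 : 0 <= q i * (1 - q i) by rewrite mulr_ge0 // subr_ge0.
  rewrite /p PQ -/(q i) subrr.
  rewrite expr0n mulr0 mul0r add0r mulrCA -exprMn [_^-1 * _]mulrC.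
  rewrite ler_piMr ?sqr_ge0 // exprn_ile1 //; first by rewrite divr_ge0 // ltW.
  by rewrite ler_pdivrMr // mul1r /v lerDl ltW.
have h := ler_wpM2l (sqr_ge0 (m%:R : R)) large_m.
have := mulr_ge0 (sqr_ge0 (m%:R : R)) (le_trans ler01 n1).
move: Vle h; rewrite (_ : (m%:R ^+ 2 * eps ^+ 2 / 64%:R) ^+ 2 =
  (m%:R ^+ 2 * (m%:R ^+ 2 * eps ^+ 4)) / 4096%:R); last by field.
rewrite (mulrCA (m%:R ^+ 2)); move: (m%:R ^+ 2 * n%:R) (m%:R ^+ 2 * (m%:R ^+ 2 * eps ^+ 4)) => a b; lra.
Qed.

(** The choice [tau = eps^2 / n] makes the additive error [n tau / 2] equal to [eps^2 / 2], which
    leaves the other half to [16 S]. *)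
Lemma far_chi_square_ge : eps < l1_dist P Q -> eps ^+ 2 <= 32%:R * S.
Proof.
move=> far; have := l1_dist_sqr_le prodP prodQ tau0.
have : eps ^+ 2 <= l1_dist P Q ^+ 2 by rewrite lerXn2r ?nnegrE ?ltW // (lt_trans eps0).
rewrite -/S (_ : n%:R * tau = eps ^+ 2); first lra.
by rewrite /tau; field; rewrite gt_eqF // ltr0n.
Qed.

(** Divided by [m^2] and with [X = m S], the variance is at most
    [2 X + X^2 / 50 + 52 S / tau + 2 n]. The bounds [X >= 112], [1000 n <= X^2] and
    [4000 S / tau <= X^2] bring this below [X^2 / 12]. The factor 12 is 3 for the confidence times 4
    for deviations of half the mean. *)
Lemma far_variance_le :
  eps ^+ 2 <= 32%:R * S -> 12%:R * V <= (m%:R ^+ 2 * S) ^+ 2.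
Proof.
move=> Sge; have s0 i : 0 <= (p i - q i) ^+ 2 / v i.
  by rewrite divr_ge0 ?sqr_ge0 // ltW.
have e20 : 0 < eps ^+ 2 by rewrite exprn_gt0.
have S0 : 0 < S by lra.
have Vle : V <= 2%:R * m%:R ^+ 3 * S + m%:R ^+ 4 * S ^+ 2 / 50%:R
    + 52%:R * m%:R ^+ 2 * (S / tau) + 2%:R * m%:R ^+ 2 * n%:R.
  apply: (@le_trans _ _ (\sum_i (2%:R * m%:R ^+ 3 * ((p i - q i) ^+ 2 / v i)
     + m%:R ^+ 4 * ((p i - q i) ^+ 2 / v i) ^+ 2 / 50%:R
     + 52%:R * m%:R ^+ 2 * ((p i - q i) ^+ 2 / v i / tau) + 2%:R * m%:R ^+ 2))).
    by apply: ler_sum => i _; apply: coord_variance_le => //; apply: mean_in01.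
  rewrite !big_split /= sumr_const card_ord -[_ *+ n]mulr_natr lerD2r.
  rewrite -!mulr_sumr -!mulr_suml -mulr_sumr -/S lerD2r lerD2l.
  by rewrite ler_wpM2r ?invr_ge0 ?ler0n // ler_wpM2l ?exprn_ge0 // sum_sqr_le.
have m0 : 0 <= m%:R :> R by rewrite ler0n.
have me : 3600%:R <= m%:R * eps ^+ 2.
  rewrite -(@ler_pXn2r _ 2) ?nnegrE ?ler0n //; last by rewrite mulr_ge0 // ltW.
  rewrite exprMn -exprM; apply: le_trans large_m.
  by rewrite ler_peMr // exprn_ge0 ?ler0n.
(* From [m eps^2 >= 3600] and [eps^2 <= 32 S], as [3600 / 32 > 112]. *)
have X112 : 112%:R <= m%:R * S by have := ler_wpM2l m0 Sge; lra.
have XX : 112%:R * (m%:R * S) <= (m%:R * S) ^+ 2.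
  by rewrite [leRHS]expr2 ler_wpM2r //; lra.
have Xn : 1000%:R * n%:R <= (m%:R * S) ^+ 2.
  have h : m%:R ^+ 2 * eps ^+ 4 <= m%:R ^+ 2 * (1024%:R * S ^+ 2).
    rewrite ler_wpM2l ?sqr_ge0 //.
    have : (eps ^+ 2) ^+ 2 <= (32%:R * S) ^+ 2.
      by rewrite lerXn2r ?nnegrE //; lra.
    by rewrite -exprM exprMn; lra.
  rewrite exprMn; move: large_m h n1; move: (m%:R ^+ 2 * eps ^+ 4) => a.
  rewrite mulrCA; move: (m%:R ^+ 2 * S ^+ 2) => b; lra.
(* Here [S / tau = S n / eps^2]; one factor [eps^2] of [large_m] cancels the denominator and another
   is traded for [32 S]. *)
have Xt : 4000%:R * (S / tau) <= (m%:R * S) ^+ 2.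
  have -> : S / tau = S * n%:R / eps ^+ 2.
    by rewrite /tau; field; rewrite !gt_eqF // ltr0n.
  rewrite mulrA ler_pdivrMr //.
  have h := ler_wpM2l (ltW S0) large_m.
  have h2 : m%:R ^+ 2 * eps ^+ 2 * S * eps ^+ 2 <= m%:R ^+ 2 * eps ^+ 2 * S * (32%:R * S).
    by rewrite ler_wpM2l // !mulr_ge0 ?sqr_ge0 // ltW.
  have Sn := mulr_ge0 (ltW S0) (le_trans ler01 n1).
  rewrite (_ : S * (m%:R ^+ 2 * eps ^+ 4) = m%:R ^+ 2 * eps ^+ 2 * S * eps ^+ 2) in h;
    last by ring.
  rewrite (_ : _ * (32%:R * S) = 32%:R * ((m%:R * S) ^+ 2 * eps ^+ 2)) in h2;
    last by ring.
  rewrite mulrCA in h; lra.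
have : 2%:R * (m%:R * S) + (m%:R * S) ^+ 2 / 50%:R + 52%:R * (S / tau) + 2%:R * n%:R
  <= (m%:R * S) ^+ 2 / 12%:R.
  move: XX Xn Xt (sqr_ge0 (m%:R * S)); move: (S / tau) (m%:R * S) => a b; lra.
move=> /(ler_wpM2l (sqr_ge0 (m%:R : R))).
have -> : m%:R ^+ 2 * ((m%:R * S) ^+ 2 / 12%:R) = (m%:R ^+ 2 * S) ^+ 2 / 12%:R by field.
move: Vle; move: V (S / tau) => V' a.
set b := m%:R ^+ 2 * (_ + _).
rewrite (_ : _ + 2%:R * m%:R ^+ 2 * n%:R = b); last by rewrite /b; field.
move: b (_ ^+ 2) => b c; lra.
Qed.

End Separation.

(** * Error probabilities of the acceptance rule *)

Section Chebyshev.
Context {R : realType} {n : nat}.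
Variables P Q : {ffun cube n -> R}.
Hypotheses (prodP : is_product_distr P) (prodQ : is_product_distr Q).
Variables (m : nat) (eps : R).
Hypotheses (n_gt0 : (0 < n)%N) (eps0 : 0 < eps).
Hypothesis large_m : 3600%:R ^+ 2 * n%:R <= m%:R ^+ 2 * eps ^+ 4.

Let q := mean_vector Q.
Let w i := (q i * (1 - q i) + eps ^+ 2 / n%:R)^-1.

Definition accepts (xs ys : seq (cube n)) : bool :=
  64%:R * two_batch_stat q w xs ys < m%:R ^+ 2 * eps ^+ 2.

Let distrP : is_distr P. Proof. by case: prodP. Qed.

Let p i := coord_pr P i true.
Let mu := m%:R ^+ 2 * \sum_i w i * (p i - q i) ^+ 2.
Let V := \sum_i w i ^+ 2 * (2%:R * m%:R ^+ 3 * (p i - q i) ^+ 2 * (p i * (1 - p i))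
                       + m%:R ^+ 2 * (p i * (1 - p i)) ^+ 2).

(** Pointwise, the indicator of the answer [b] is at least [1 - (Z - mu)^2 / a]; averaging leaves
    [1 - V / a]. *)
Lemma expect_chebyshev (b : bool) (a : R) : 0 < a ->
  (forall xs ys, accepts xs ys != b -> a <= (two_batch_stat q w xs ys - mu) ^+ 2) ->
  3%:R * V <= a ->
  2%:R / 3%:R <= expect P m (fun xs => expect P m (fun ys => (accepts xs ys == b)%:R)).
Proof.
move=> a0 dev Va.
apply: (@le_trans _ _ (expect P m (fun xs => expect P m (fun ys =>
    1 + (- a^-1) * (two_batch_stat q w xs ys - mu) ^+ 2)))); last first.
  apply: le_expect => // xs _; apply: le_expect => // ys _.
  case: eqP => [_|/eqP /dev h] /=.
    by rewrite gerDl mulNr oppr_le0 mulr_ge0 ?sqr_ge0 // invr_ge0 ltW.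
  by rewrite mulNr subr_le0 mulrC ler_pdivlMr ?mul1r.
rewrite (@eq_expect _ _ _ m _ (fun xs => 1 +
    (- a^-1) * expect P m (fun ys => (two_batch_stat q w xs ys - mu) ^+ 2))); last first.
  by move=> xs _; rewrite expectD expectZ expect_cst.
rewrite expectD expectZ expect_cst // two_batch_variance // -/V.
have : V / a <= 3%:R^-1 by rewrite ler_pdivrMr //; lra.
by rewrite mulNr mulrC; lra.
Qed.

Let m2e2 : 0 < m%:R ^+ 2 * eps ^+ 2.
Proof.
have : 0 < m%:R ^+ 2 * eps ^+ 4.
  apply: lt_le_trans large_m; rewrite mulr_gt0 ?ltr0n // exprn_gt0 // ltr0n //.
rewrite (_ : m%:R ^+ 2 * eps ^+ 4 = m%:R ^+ 2 * eps ^+ 2 * eps ^+ 2); last by ring.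
by rewrite pmulr_lgt0 // exprn_gt0.
Qed.

Let qE i : q i = coord_pr Q i true. Proof. by rewrite ffunE. Qed.

Lemma expect_accepts_null : P = Q -> 2%:R / 3%:R <=
  expect P m (fun xs => expect P m (fun ys => (accepts xs ys == true)%:R)).
Proof.
move=> PQ; have mu0 : mu = 0.
  rewrite /mu big1 ?mulr0 // => i _.
  by rewrite qE /p PQ subrr expr0n mulr0.
have Vle : 3%:R * V <= (m%:R ^+ 2 * eps ^+ 2 / 64%:R) ^+ 2.
  apply: le_trans (null_variance_le prodQ n_gt0 eps0 large_m PQ).
  rewrite le_eqVlt; apply/orP; left; apply/eqP; congr (_ * _).
  by apply: eq_bigr => i _; rewrite /w !qE.
clear PQ; apply: (@expect_chebyshev _ ((m%:R ^+ 2 * eps ^+ 2 / 64%:R) ^+ 2)).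
- by rewrite exprn_gt0 // divr_gt0 // ltr0n.
- move=> xs ys; rewrite eqb_id /accepts -leNgt mu0 subr0 => h.
  move: m2e2 h; move: (m%:R ^+ 2 * _) (two_batch_stat _ _ _ _) => a z a0 h.
  by rewrite lerXn2r ?nnegrE; lra.
- exact: Vle.
Qed.

Lemma expect_accepts_far : eps < l1_dist P Q -> 2%:R / 3%:R <=
  expect P m (fun xs => expect P m (fun ys => (accepts xs ys == false)%:R)).
Proof.
move=> far.
pose S := \sum_i (p i - coord_pr Q i true) ^+ 2 /
  (coord_pr Q i true * (1 - coord_pr Q i true) + eps ^+ 2 / n%:R).
have Sge : eps ^+ 2 <= 32%:R * S := far_chi_square_ge prodP prodQ n_gt0 eps0 far.
have muE : mu = m%:R ^+ 2 * S.
  by congr (_ * _); apply: eq_bigr => i _; rewrite /w qE mulrC.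
have mule : m%:R ^+ 2 * eps ^+ 2 <= 32%:R * mu.
  by rewrite muE [leRHS]mulrCA ler_wpM2l // sqr_ge0.
have mu0 : 0 < mu by have := m2e2; lra.
(* The threshold [m^2 eps^2 / 64] is at most [mu / 2], so a wrong acceptance deviates from the mean
   by at least [mu / 2]. *)
apply: (@expect_chebyshev _ (mu ^+ 2 / 4%:R)).
- by rewrite divr_gt0 ?ltr0n // exprn_gt0.
- move=> xs ys; rewrite eqbF_neg negbK /accepts => h.
  rewrite -[leRHS]sqrrN opprB (_ : mu ^+ 2 / 4%:R = (mu / 2%:R) ^+ 2); last by field.
  move: (two_batch_stat _ _ _ _) h => z h.
  have zle : z <= mu / 2%:R by lra.
  by rewrite lerXn2r ?nnegrE; lra.
- have := far_variance_le prodP prodQ n_gt0 eps0 large_m Sge.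
  rewrite -/S -muE.
  rewrite (_ : \sum_i _ = V); first lra.
  by apply: eq_bigr => i _; rewrite /w !qE.
Qed.

End Chebyshev.

(** * Program runs and a Hoare logic with exact cost *)

Section Executions.
Context {R : realType} {n : nat}.
Local Notation config := (@config R).
Local Notation state := (@state R).

(** There is no rule for coin flips: the tester is deterministic once its samples are fixed. *)
Inductive steps : nat -> seq (cube n) -> config -> config -> Prop :=
  | StepsRefl c : steps 0 [::] c c
  | StepsContinue t xs c c1 c2 of
      step n c = Continue n c1 & steps t xs c1 c2 : steps t.+1 xs c c2
  | StepsSample t x xs c k c2 of
      step n c = AskSample k & steps t xs (k x) c2 : steps t.+1 (x :: xs) c c2.

Lemma steps_trans t1 t2 xs1 xs2 c1 c2 c3 :
  steps t1 xs1 c1 c2 -> steps t2 xs2 c2 c3 -> steps (t1 + t2) (xs1 ++ xs2) c1 c3.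
Proof.
move=> st12; elim: st12 c3 => //= [t xs c d d' e _ IH|t x xs c k d' e _ IH] c3 st.
- by apply: StepsContinue e _; apply: IH.
- by apply: StepsSample e _; apply: IH.
Qed.

(** Passes from individual runs to probabilities: if every sample list of length [m] leads to a halt
    after the same time [t], both recursions unfold along these runs. *)
Lemma halting_run t m (c : config) (f : seq (cube n) -> bool) :
  (forall xs, size xs = m ->
     exists2 s, steps t xs c ([::], s) & (nreg s 0 != 0%N) = f xs) ->
  halts_within n t m c /\
  forall (P : {ffun cube n -> R}) b, is_distr P ->
    answer_pr P b t c = expect P m (fun xs => (f xs == b)%:R).
Proof.
elim: t m c f => [|t IH] m c f runs.
  have [s st fE] := runs (nseq m [ffun=> false]) (size_nseq _ _).
  case: m runs st fE => [|m] runs st fE; last by inversion st.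
  inversion st; subst c => /=; split=> // P b _.
  by rewrite fE.
(* An arbitrary sample list reveals the kind of the first step; [step] is a function, so every other
   list starts with the same kind. *)
have [s st fE] := runs (nseq m [ffun=> false]) (size_nseq _ _).
inversion st as [|t' xs c0 c1 c2 e st'|t' x xs c0 k c2 e st'].
  have [] := IH m c1 f.
    move=> ys sz; have [s' st2 fE'] := runs ys sz; exists s' => //.
    inversion st2 as [|u vs d d1 d2 e' st2'|u y vs d k d2 e' st2'].
      by move: e'; rewrite e => -[->].
    by move: e'; rewrite e.
  by move=> h a; rewrite /= e; split.
clear st'; case: m runs {st fE} H0 => [//|m] runs _.
have hk y : halts_within n t m (k y) /\ forall (P : {ffun cube n -> R}) b, is_distr P ->
    answer_pr P b t (k y) = expect P m (fun ys => (f (y :: ys) == b)%:R).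
  apply: IH => ys sz; have [|s' st2 fE'] := runs (y :: ys); first by rewrite /= sz.
  exists s' => //.
  inversion st2 as [|u vs d d1 d2 e' st2'|u z vs d k' d2 e' st2'].
    by move: e'; rewrite e.
  by move: e'; rewrite e => -[->].
rewrite /= e; split; first by move=> y; case: (hk y).
by move=> P b dP; apply: eq_bigr => y _; case: (hk y) => _ ->.
Qed.

(** Time and samples are exact since [halting_run] asks for one common time; the arbitrary
    continuation [k] makes triples compose. *)
Definition hoare (A : state -> Prop) (c : cmd) (t : nat) (xs : seq (cube n))
    (B : state -> Prop) : Prop :=
  forall s k, A s -> exists2 s', steps t xs (c :: k, s) (k, s') & B s'.

Lemma hoare_weaken (A A' : state -> Prop) c t xs (B B' : state -> Prop) :
  hoare A c t xs B -> (forall s, A' s -> A s) -> (forall s, B s -> B' s) ->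
  hoare A' c t xs B'.
Proof. by move=> h AA BB s k /AA /h - /(_ k)[s' st /BB]; exists s'. Qed.

Lemma hoare_skip A : hoare A Skip 1 [::] A.
Proof. by move=> s k a; exists s => //; apply: StepsContinue (StepsRefl _). Qed.

Lemma hoare_setN (A B : state -> Prop) r e :
  (forall s, A s -> B (set_nreg s r (neval s e))) -> hoare A (SetN r e) 1 [::] B.
Proof.
move=> AB s k /AB b; exists (set_nreg s r (neval s e)) => //.
exact: StepsContinue (StepsRefl _).
Qed.

Lemma hoare_setR (A B : state -> Prop) a e v :
  (forall s, A s -> B (set_cell s a (neval s e) (reval s v))) ->
  hoare A (SetR a e v) 1 [::] B.
Proof.
move=> AB s k /AB b; exists (set_cell s a (neval s e) (reval s v)) => //.
exact: StepsContinue (StepsRefl _).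
Qed.

Lemma hoare_draw (A B : state -> Prop) a x :
  (forall s, A s -> B (load_sample s a x)) -> hoare A (Draw a) 1 [:: x] B.
Proof.
move=> AB s k /AB b; exists (load_sample s a x) => //.
by apply: (@StepsSample 0 x [::] _ (fun x => (k, load_sample s a x))) => //; apply: StepsRefl.
Qed.

Lemma hoare_seq (A B C : state -> Prop) c1 c2 t1 t2 xs1 xs2 :
  hoare A c1 t1 xs1 B -> hoare B c2 t2 xs2 C ->
  hoare A (Seq c1 c2) (t1 + t2).+1 (xs1 ++ xs2) C.
Proof.
move=> h1 h2 s k a; have [s1 st1 b] := h1 s (c2 :: k) a.
have [s2 st2 c] := h2 s1 k b.
by exists s2 => //; apply: StepsContinue (steps_trans st1 st2).
Qed.

Lemma hoare_if (A B : state -> Prop) g b c1 c2 t xs :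
  (forall s, A s -> beval s g = b) -> hoare A (if b then c1 else c2) t xs B ->
  hoare A (If g c1 c2) t.+1 xs B.
Proof.
move=> gE h s k a; have [s' st ?] := h s k a; exists s' => //.
by apply: StepsContinue st => /=; rewrite gE.
Qed.

(** A round costs [t] steps and one guard test; the last successor is the failing test. The
    induction is on the number of remaining rounds. *)
Lemma hoare_while (I : nat -> state -> Prop) g c t N (f : nat -> seq (cube n)) :
  (forall i s, (i <= N)%N -> I i s -> beval s g = (i < N)%N) ->
  (forall i, (i < N)%N -> hoare (I i) c t (f i) (I i.+1)) ->
  hoare (I 0%N) (While g c) (N * t.+1).+1 (flatten (mkseq f N)) (I N).
Proof.
move=> gE body.
suff loop d j : (j + d = N)%N ->
    hoare (I j) (While g c) (d * t.+1).+1 (flatten [seq f i | i <- iota j d]) (I N).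
  exact: loop.
elim: d j => [|d IH] j jd s k Ij.
  rewrite addn0 in jd; subst j; exists s => //.
  by apply: StepsContinue (StepsRefl _); rewrite /= (gE N) // ltnn.
have jN : (j < N)%N by rewrite -jd addnS ltnS leq_addr.
have [s1 st1 I1] := body j jN s (While g c :: k) Ij.
have [|s2 st2 I2] := IH j.+1 _ s1 k I1; first by rewrite addSnnS.
exists s2 => //=; rewrite mulSn -addnS.
apply: (@StepsContinue _ _ _ ([:: c, While g c & k], s)); last exact: steps_trans st1 st2.
by rewrite /= (gE j) ?jN // ltnW.
Qed.

Definition incr r := SetN r (NAdd (NReg r) (NConst 1)).

Definition for_loop r bound body :=
  Seq (SetN r (NConst 0)) (While (BNLt (NReg r) (NReg bound)) (Seq body (incr r))).

(** A round pays for the body, the increment, their [Seq] and the guard; the rest is the outer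
    [Seq], the initialization and the failing guard. *)
Definition for_time N t : nat := (1 + (N * (t + 1).+2).+1).+1.

Lemma hoare_for (A : state -> Prop) (I : nat -> state -> Prop) r bound body t N
    (f : nat -> seq (cube n)) :
  (forall i s, I i s -> nreg s r = i /\ nreg s bound = N) ->
  (forall s, A s -> I 0%N (set_nreg s r 0)) ->
  (forall i, (i < N)%N -> hoare (I i) body t (f i)
     (fun s => nreg s r = i /\ I i.+1 (set_nreg s r i.+1))) ->
  hoare A (for_loop r bound body) (for_time N t) (flatten (mkseq f N)) (I N).
Proof.
move=> IE init loop; rewrite -[flatten _]cat0s.
apply: (@hoare_seq _ (I 0%N)); first exact: hoare_setN.
apply: hoare_while => [i s _ /IE[/= -> -> //]|i iN].
rewrite -[f i]cats0; apply: hoare_seq (loop i iN) _.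
by apply: hoare_setN => s [/= ri ?]; rewrite ri addn1.
Qed.

End Executions.

(** * The tester as a program *)

Definition cst_r (k : nat) : rexp := RNat (NConst k).
Definition eps_r : rexp := RCell 1 (NConst 0).
Definition dim_r : rexp := RNat (NReg 1).
Definition batch_r : rexp := RNat (NReg 2).
Definition eps2_r : rexp := RMul eps_r eps_r.
Definition batch2_r : rexp := RMul batch_r batch_r.
Definition stat_r : rexp := RCell 5 (NConst 0).
Definition mean_r : rexp := RCell 0 (NReg 4).

(* Register 1 holds [n], register 2 the batch size, registers 3 and 4 count
   samples and coordinates; array 2 holds the current sample, arrays 3 and 4
   the deviations of the two batches, cell 0 of array 5 the statistic. *)
Definition choose_batch_size : cmd :=
  While (BRLt (RMul batch2_r (RMul eps2_r eps2_r))
              (RMul (RMul (cst_r 3600) (cst_r 3600)) dim_r))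
        (incr 2).

Definition add_sample (a : nat) : cmd :=
  for_loop 4 1
    (SetR a (NReg 4)
       (RAdd (RCell a (NReg 4)) (RSub (RCell 2 (NReg 4)) mean_r))).

Definition draw_batch (a : nat) : cmd :=
  for_loop 3 2 (Seq (Draw 2) (add_sample a)).

Definition compute_stat : cmd :=
  for_loop 4 1
    (SetR 5 (NConst 0)
       (RAdd stat_r
          (RDiv (RMul (RCell 3 (NReg 4)) (RCell 4 (NReg 4)))
                (RAdd (RMul mean_r (RSub (cst_r 1) mean_r)) (RDiv eps2_r dim_r))))).

Definition decide : cmd :=
  If (BRLt (RMul (cst_r 64) stat_r) (RMul batch2_r eps2_r))
     (SetN 0 (NConst 1)) Skip.

Definition main_test : cmd :=
  Seq choose_batch_size
    (Seq (draw_batch 3) (Seq (draw_batch 4) (Seq compute_stat decide))).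

(* For [eps >= 2] no pair of distributions is [eps]-far, and for [n = 0] there is
   only one distribution: the sample bound then forbids drawing any sample. *)
Definition identity_tester : cmd :=
  If (BAnd (BNLt (NConst 0) (NReg 1)) (BRLt eps_r (cst_r 2)))
     main_test (SetN 0 (NConst 1)).

(** * The program computes the acceptance rule *)

Section TesterCorrect.
Context {R : realType} {n : nat}.
Variables (q : {ffun 'I_n -> R}) (eps : R).
Local Notation state := (@state R).

(** Registers 3 and 4 and array 2 are left unconstrained, so counters and the current sample may
    change freely. *)
Record memory (m : nat) (D : nat -> 'I_n -> R) (z : R) (s : state) : Prop := Memory {
  memory_answer : nreg s 0 = 0%N;
  memory_dim : nreg s 1 = n;
  memory_batch : nreg s 2 = m;
  memory_mean : forall k : 'I_n, rarr s 0 k = q k;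
  memory_eps : rarr s 1 0 = eps;
  memory_dev : forall a, a \in [:: 3%N; 4%N] -> forall k : 'I_n, rarr s a k = D a k;
  memory_stat : rarr s 5 0 = z }.

Lemma rarr_set_cell (s : state) a i v b j :
  rarr (set_cell s a i v) b j = if (b == a) && (j == i) then v else rarr s b j.
Proof. by []. Qed.

Lemma memory_ext m D D' z z' s :
  (forall a k, a \in [:: 3%N; 4%N] -> D a k = D' a k) -> z = z' ->
  memory m D z s -> memory m D' z' s.
Proof.
by move=> DD <- [? ? ? ? ? Ds ?]; split=> // a ha k; rewrite -DD // Ds.
Qed.

Lemma memory_set_counter m D z s r v :
  r \in [:: 3%N; 4%N] -> memory m D z s -> memory m D z (set_nreg s r v).
Proof. by rewrite !inE => /orP[] /eqP -> [] *; split. Qed.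

Lemma hoare_add_sample m D z a x (A : state -> Prop) j :
  a \in [:: 3%N; 4%N] ->
  (forall s, A s -> [/\ memory m D z s, nreg s 3 = j
                      & forall k : 'I_n, rarr s 2 k = (x k : nat)%:R]) ->
  @hoare R n A (add_sample a) (for_time n 1) [::]
    (fun s => memory m (fun b k => D b k + (if b == a then (x k : nat)%:R - q k else 0)) z s
              /\ nreg s 3 = j).
Proof.
move=> ha AE.
pose I i s := [/\ memory m (fun b (k : 'I_n) => D b k +
     (if (b == a) && (k < i)%N then (x k : nat)%:R - q k else 0)) z s,
   nreg s 3 = j, nreg s 4 = i & forall k : 'I_n, rarr s 2 k = (x k : nat)%:R].
(* No sample is drawn here; the empty trace is written as a concatenation of empty ones to fit the
   loop rule. *)
have -> : [::] = flatten (mkseq (fun _ => [::] : seq (cube n)) n).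
  by rewrite /mkseq; elim: (iota 0 n).
apply: (hoare_weaken (A := A) (B := I n)) => //; last first.
  move=> s [mem rj _ _]; split=> //; apply: memory_ext mem => // b k _.
  by rewrite ltn_ord andbT.
apply: hoare_for => [i s [mem _ ri _]|s /AE[mem rj xs]|i iN].
- by rewrite ri (memory_dim mem).
- split=> //; apply: memory_set_counter => //; apply: memory_ext mem => // b k _.
  by rewrite ltn0 andbF addr0.
pose o := Ordinal iN.
apply: hoare_setR => s [mem rj ri xs] /=; rewrite ri; split=> //.
have xo : rarr s 2 i = (x o : nat)%:R := xs o.
have qo : rarr s 0 i = q o := memory_mean mem o.
have Do := memory_dev mem ha o; rewrite /= eqxx ltnn addr0 in Do.
split=> //; last first.
  move=> k; rewrite [rarr _ _ _]rarr_set_cell (_ : 2%N == a = false) ?xs //.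
  by move: ha; rewrite !inE => /orP[]/eqP->.
have a5 : (5%N == a = false) /\ (0%N == a = false) /\ (1%N == a = false).
  by move: ha; rewrite !inE => /orP[]/eqP->.
case: a5 => a5 [a0 a1].
apply: memory_set_counter => //; case: mem => m0 m1 m2 mq me mD mz; split=> //.
- by move=> k; rewrite rarr_set_cell a0 mq.
- by rewrite rarr_set_cell a1 me.
- move=> b hb k; rewrite rarr_set_cell mD // Do xo qo.
  case: eqP => [->|] //=; rewrite [in RHS]ltnS [in RHS]leq_eqVlt.
  case: (eqVneq (k : nat) i) => [ki|ki] //=.
  by have -> : k = o by apply: val_inj.
- by rewrite rarr_set_cell a5 mz.
Qed.

Lemma hoare_draw_batch m D z a (xs : seq (cube n)) :
  a \in [:: 3%N; 4%N] -> size xs = m ->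
  @hoare R n (memory m D z) (draw_batch a) (for_time m (1 + for_time n 1).+1) xs
    (memory m (fun b k => D b k + (if b == a then batch_dev q xs k else 0)) z).
Proof.
move=> ha sz.
pose x0 : cube n := [ffun=> false].
pose I i s := memory m (fun b k => D b k +
   (if b == a then batch_dev q (take i xs) k else 0)) z s /\ nreg s 3 = i.
have {1}-> : xs = flatten (mkseq (fun i => [:: nth x0 xs i]) m).
  by rewrite -{1}(mkseq_nth x0 xs) sz /mkseq; elim: (iota 0 m) => //= i l <-.
apply: (hoare_weaken (A := memory m D z) (B := I m)) => //; last first.
  by move=> s [mem _]; apply: memory_ext mem => // b k _; rewrite -sz take_size.
apply: hoare_for => [i s [mem ri]|s mem|i im].
- by rewrite ri (memory_batch mem).
- split=> //; apply: memory_set_counter => //; apply: memory_ext mem => // b k _.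
  by rewrite take0 /batch_dev big_nil if_same addr0.
rewrite -[[:: _]]cats0.
set x := nth x0 xs i.
pose B s := [/\ memory m (fun b k => D b k +
   (if b == a then batch_dev q (take i xs) k else 0)) z s,
   nreg s 3 = i & forall k : 'I_n, rarr s 2 k = (x k : nat)%:R].
apply: (@hoare_seq _ _ _ B).
  apply: hoare_draw => s [[m0 m1 m2 mq me mD mz] ri]; split=> //.
    split=> // b; rewrite !inE => hb k /=; rewrite -mD ?inE //.
    by case/orP: hb => /eqP->.
  by move=> k /=; rewrite valK.
apply: hoare_weaken (hoare_add_sample ha (fun s (b : B s) => b)) _ _ => // s [mem ri].
split=> //; split=> //; apply: memory_set_counter => //.
apply: memory_ext mem => // b k _; case: eqP => // _; last by rewrite !addr0.
by rewrite (take_nth x0) ?sz // /batch_dev -cats1 big_cat big_seq1 /= -addrA.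
Qed.

Let w i := (q i * (1 - q i) + eps ^+ 2 / n%:R)^-1.

Lemma hoare_compute_stat m D :
  @hoare R n (memory m D 0) compute_stat (for_time n 1) [::]
    (memory m D (\sum_k w k * (D 3%N k * D 4%N k))).
Proof.
pose I i s := memory m D (\sum_(k < n | (k < i)%N) w k * (D 3%N k * D 4%N k)) s
  /\ nreg s 4 = i.
have -> : [::] = flatten (mkseq (fun _ => [::] : seq (cube n)) n).
  by rewrite /mkseq; elim: (iota 0 n).
apply: (hoare_weaken (A := memory m D 0) (B := I n)) => //; last first.
  move=> s [mem _]; apply: memory_ext mem => //.
  by apply: eq_bigl => k; rewrite ltn_ord.
apply: hoare_for => [i s [mem ri]|s mem|i iN].
- by rewrite ri (memory_dim mem).
- split=> //; apply: memory_set_counter => //; apply: memory_ext mem => //.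
  by rewrite big_pred0.
pose o := Ordinal iN.
apply: hoare_setR => s [mem ri] /=; rewrite ri; split=> //; split=> //.
apply: memory_set_counter => //.
have qo : rarr s 0 i = q o := memory_mean mem o.
have D3 : rarr s 3 i = D 3%N o := @memory_dev _ _ _ _ mem 3%N isT o.
have D4 : rarr s 4 i = D 4%N o := @memory_dev _ _ _ _ mem 4%N isT o.
case: mem => m0 m1 m2 mq me mD mz; split=> //=.
  by move=> b; rewrite !inE => hb k; rewrite -mD ?inE //; case/orP: hb => /eqP->.
rewrite mz m1 me qo D3 D4 [in RHS](bigD1 o) //= addrC -expr2 [w o * _]mulrC.
congr (_ + _).
by apply: eq_bigl => k; rewrite ltnS -val_eqE /=; case: ltngtP.
Qed.

(** Both branches of [decide] take one step, so the time depends on [n] and [m] only. *)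
Definition test_time m : nat :=
  ((m * 2).+1 + (for_time m (1 + for_time n 1).+1 +
    (for_time m (1 + for_time n 1).+1 + (for_time n 1 + 2).+1).+1).+1).+2.

Lemma hoare_identity_tester m xs ys :
  (0 < n)%N -> eps < 2%:R ->
  (forall i, (i%:R ^+ 2 * eps ^+ 4 < 3600%:R ^+ 2 * n%:R) = (i < m)%N) ->
  size xs = m -> size ys = m ->
  @hoare R n (eq (init_state q eps)) identity_tester (test_time m) (xs ++ ys)
    (fun s => (nreg s 0 != 0%N) =
       (64%:R * two_batch_stat q w xs ys < m%:R ^+ 2 * eps ^+ 2)).
Proof.
move=> n0 eps2 mE szx szy.
apply: (@hoare_if _ _ _ _ _ true) => [s <- /=|]; first by rewrite n0 eps2.
pose D0 (b : nat) (k : 'I_n) : R := 0.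
rewrite -[xs ++ ys]cat0s.
apply: (@hoare_seq _ _ _ (memory m D0 0)).
  pose I i s := memory i D0 0 s.
  have -> : [::] = flatten (mkseq (fun _ => [::] : seq (cube n)) m).
    by rewrite /mkseq; elim: (iota 0 m).
  apply: (hoare_weaken (A := I 0%N) (B := I m)) => //; last first.
    move=> s <-; split=> //= [k|a]; first by rewrite valK.
    by rewrite !inE => /orP[]/eqP->.
  apply: hoare_while => [i s _ [m0 m1 m2 mq me mD mz]|i im] /=.
    rewrite m1 m2 me -mE; congr (_ < _); ring.
  apply: hoare_setN => s [m0 m1 m2 mq me mD mz] /=; rewrite m2 addn1.
  by split.
apply: hoare_seq; first by apply: hoare_draw_batch.
rewrite -{1}[ys]cats0; apply: hoare_seq; first by apply: hoare_draw_batch.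
rewrite -[[::]]cat0s; apply: hoare_seq; first by apply: hoare_compute_stat.
set z := \sum_k _.
have zE : z = two_batch_stat q w xs ys.
  by apply: eq_bigr => k _; rewrite /D0 /= !add0r !addr0.
pose acc := 64%:R * two_batch_stat q w xs ys < m%:R ^+ 2 * eps ^+ 2.
apply: (@hoare_if _ _ _ _ _ acc) => [s [m0 m1 m2 mq me mD mz] /=|].
  by rewrite m2 me mz zE -!expr2.
case E : acc; rewrite /acc in E.
  by apply: hoare_setN => s _ /=; rewrite E.
refine (hoare_weaken (@hoare_skip R n _) (fun s h => h) _) => s.
by case=> m0 *; rewrite m0 E.
Qed.

End TesterCorrect.

(** * Degenerate inputs, batch size and the final bounds *)

Lemma hoare_tester_trivial (R : realType) (n : nat) (q : {ffun 'I_n -> R}) (eps : R) :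
  ~~ ((0 < n)%N && (eps < 2%:R)) ->
  @hoare R n (eq (init_state q eps)) identity_tester 2 [::]
    (fun s => (nreg s 0 != 0%N) = true).
Proof.
move=> triv; apply: (@hoare_if _ _ _ _ _ false) => [s <- /=|]; first exact/negbTE.
exact: hoare_setN.
Qed.

Lemma l1_dist_le2 (R : realType) (n : nat) (P Q : {ffun cube n -> R}) :
  is_distr P -> is_distr Q -> l1_dist P Q <= 2%:R.
Proof.
move=> [P0 P1] [Q0 Q1]; rewrite -[2%:R]/(1 + 1) -{1}P1 -Q1 -big_split /=.
apply: ler_sum => x _; apply: le_trans (ler_normB _ _) _.
by rewrite !ger0_norm.
Qed.

Lemma l1_dist_dim0 (R : realType) (P Q : {ffun cube 0 -> R}) :
  is_product_distr P -> is_product_distr Q -> l1_dist P Q = 0.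
Proof.
move=> [_ PE] [_ QE]; rewrite /l1_dist big1 // => x _.
by rewrite PE QE !big_ord0 subrr normr0.
Qed.

(** The guard of the search loop is monotone in [i], so the least index that falsifies it serves as
    [m]. Squaring [i eps^2 < 3600 sqrt n] spares the program a square root. *)
Lemma batch_size_exists (R : realType) (n : nat) (eps : R) : 0 < eps ->
  exists m : nat, forall i : nat,
    (i%:R ^+ 2 * eps ^+ 4 < 3600%:R ^+ 2 * n%:R) = (i < m)%N.
Proof.
move=> eps0; pose big (i : nat) := 3600%:R ^+ 2 * n%:R <= i%:R ^+ 2 * eps ^+ 4.
have e0 : 0 < eps ^+ 4 by rewrite exprn_gt0.
have ex : exists i, big i.
  have [i le_i] : exists i : nat, 3600%:R ^+ 2 * n%:R / eps ^+ 4 <= i%:R.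
    exists (Num.truncn (3600%:R ^+ 2 * n%:R / eps ^+ 4)).+1.
    by rewrite ltW // truncnS_gt.
  exists i.+1; rewrite /big -ler_pdivrMr //; apply: le_trans le_i _.
  by rewrite -natrX ler_nat -mulnn; nia.
case: (ex_minnP ex) => m bigm minm; exists m => i.
have [im|mi] := ltnP i m.
  by rewrite ltNge; apply/negP => /minm; rewrite leqNgt im.
rewrite ltNge (le_trans bigm) // ler_pM2r // -!natrX ler_nat leq_exp2r //.
Qed.

(** By minimality [(m - 1) eps^2 < 3600 sqrt n]; the missing [eps^2] is at most [4], hence at most
    [4 sqrt n], whence 3604. *)
Lemma batch_size_le (R : realType) (n m : nat) (eps : R) :
  0 < eps -> eps < 2%:R -> (0 < n)%N ->
  (forall i : nat, (i%:R ^+ 2 * eps ^+ 4 < 3600%:R ^+ 2 * n%:R) = (i < m)%N) ->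
  m%:R <= 3604%:R * (Num.sqrt n%:R / eps ^+ 2).
Proof.
move=> eps0 eps2 n0 mE.
have e20 : 0 < eps ^+ 2 by rewrite exprn_gt0.
set r := Num.sqrt n%:R.
have r1 : 1 <= r by rewrite -[1]sqrtr1 ler_sqrt ?ler0n // ler1n.
have r2 : r ^+ 2 = n%:R by rewrite sqr_sqrtr // ler0n.
rewrite mulrA ler_pdivlMr //.
case: m mE => [|m] mE; first by rewrite mul0r mulr_ge0 // ?ler0n // ltW // (lt_le_trans ltr01).
have : m%:R * eps ^+ 2 < 3600%:R * r.
  rewrite -(@ltr_pXn2r _ 2) ?nnegrE ?mulr_ge0 ?ler0n //; try lra.
  by rewrite exprMn [ltRHS]exprMn r2 -exprM mE.
have : eps ^+ 2 <= 4%:R by nra.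
rewrite -natr1; lra.
Qed.

Lemma test_timeE n m : test_time (n := n) m = (8 * (m * n) + 18 * m + 4 * n + 17)%N.
Proof. rewrite /test_time /for_time; lia. Qed.

Theorem theorem4p1 (R : realType) :
  exists (prog : cmd) (C : R) (K d : nat),
    forall (n : nat) (Q : {ffun cube n -> R}) (eps : R),
      is_product_distr Q -> 0 < eps ->
      exists t m : nat,
        [/\ t%:R <= K%:R * (n%:R + eps^-1 + 1) ^+ d,
            m%:R <= C * (Num.sqrt n%:R / eps ^+ 2),
            halts_within n t m (init_config prog (mean_vector Q) eps)
          & forall P : {ffun cube n -> R}, is_product_distr P ->
              (P = Q ->
                 2%:R / 3%:R <=
                   answer_pr P true t (init_config prog (mean_vector Q) eps))
              /\
              (eps < l1_dist P Q ->
                 2%:R / 3%:R <=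
                   answer_pr P false t (init_config prog (mean_vector Q) eps))].
Proof.
(* Two batches double the constant 3604. The time is [8 m n + 18 m + 4 n + 17] with [m n] and [m] at
   most [3604 y^4], and [26 * 3604 + 21 <= 30 * 3604]. *)
exists identity_tester, (2%:R * 3604%:R), (30 * 3604)%N, 4%N => n Q eps prodQ eps0.
set y := n%:R + eps^-1 + 1.
have n0 : 0 <= n%:R :> R by rewrite ler0n.
have ie0 : 0 <= eps^-1 by rewrite invr_ge0 ltW.
have y1 : 1 <= y by rewrite /y; lra.
have y41 : 1 <= y ^+ 4 by rewrite exprn_ege1.
case: (boolP ((0 < n)%N && (eps < 2%:R))) => [/andP[n_gt0 eps2]|triv]; last first.
  exists 2%N, 0%N.
  have [halt prE] := @halting_run R n 2 0 (init_config identity_tester (mean_vector Q) eps)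
    (fun _ => true) (fun xs sz => ltac:(by rewrite (size0nil sz);
      apply: (hoare_tester_trivial triv))).
  split=> //.
  - by rewrite natrM; lra.
  - by rewrite mulr_ge0 ?mulr_ge0 ?ler0n // ?invr_ge0 ?sqrtr_ge0 ?sqr_ge0.
  move=> P prodP; split=> [_|far].
    rewrite prE; last by case: prodP.
    by rewrite /=; lra.
  case/negP: triv; apply/andP; split.
    rewrite lt0n; apply/eqP => n_eq0; subst n.
    by move: far; rewrite l1_dist_dim0 // ltNge (ltW eps0).
  by apply: lt_le_trans far (l1_dist_le2 _ _); [case: prodP|case: prodQ].
have [m mE] := batch_size_exists n eps0.
have mle := batch_size_le eps0 eps2 n_gt0 mE.
exists (test_time (n := n) m), (m + m)%N.
have [halt prE] := @halting_run R n (test_time (n := n) m) (m + m)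
  (init_config identity_tester (mean_vector Q) eps)
  (fun xs => accepts Q m eps (take m xs) (drop m xs)) (fun xs sz => ltac:(by
    rewrite -{1}(cat_take_drop m xs);
    apply: (hoare_identity_tester n_gt0 eps2 mE) => //;
    rewrite ?size_takel ?size_drop ?sz ?addnK ?leq_addr)).
split=> //.
- rewrite test_timeE.
  have sy : Num.sqrt n%:R <= y.
    apply: (@le_trans _ _ n%:R); last by rewrite /y; lra.
    rewrite -[leRHS]ger0_norm // -sqrtr_sqr ler_sqrt ?sqr_ge0 // -natrX ler_nat.
    by rewrite -mulnn leq_pmulr.
  have ey : eps^-1 ^+ 2 <= y ^+ 2 by rewrite lerXn2r ?nnegrE //; rewrite /y; lra.
  have my : m%:R <= 3604%:R * y ^+ 3.
    apply: le_trans mle _; rewrite ler_wpM2l ?ler0n // [in leRHS]exprS -exprVn.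
    by rewrite ler_pM ?sqrtr_ge0 ?sqr_ge0.
  have mny : m%:R * n%:R <= 3604%:R * y ^+ 4.
    by rewrite exprSr mulrA ler_pM ?ler0n // /y; lra.
  have y34 : y ^+ 3 <= y ^+ 4 by rewrite ler_weXn2l.
  have ny : n%:R <= y ^+ 4 by apply: (@le_trans _ _ y); rewrite ?ler_eXnr // /y; lra.
  by rewrite !natrD !natrM; lra.
- by rewrite natrD -mulrA; lra.
have large : 3600%:R ^+ 2 * n%:R <= m%:R ^+ 2 * eps ^+ 4 by rewrite leNgt mE ltnn.
move=> P prodP; have distrP : is_distr P by case: prodP.
have prE' b : answer_pr P b (test_time (n := n) m)
    (init_config identity_tester (mean_vector Q) eps) =
  expect P m (fun xs => expect P m (fun ys => (accepts Q m eps xs ys == b)%:R)).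
  (* The list of [m + m] samples splits into two independent batches. *)
  rewrite prE // expect_cat; apply: eq_expect => xs szx; apply: eq_expect => ys _.
  by rewrite take_size_cat ?drop_size_cat.
by split=> h; rewrite prE'; [apply: expect_accepts_null|apply: expect_accepts_far].
Qed.
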